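(* The maximum of the inclusterability index $Q(P,\sigma)$ over all signatures $\sigma$ of the Petersen graph $P$ equals $3$.
   Context: The Petersen graph $P$ has vertices $v_{ij}$ for the 2-element subsets $\{i,j\}\subseteq\{1,\dots,5\}$, with $v_{ij}v_{kl}$ an edge iff $\{i,j\}\cap\{k,l\}=\emptyset$; a signature is $\sigma:E(P)\to\{+,-\}$. A signed graph is clusterable if its vertex set can be partitioned into sets (clusters) such that every edge within a cluster is positive and every edge between two clusters is negative. The inclusterability index $Q$ is the smallest number of edges whose deletion leaves a clusterable signed graph. *)

(* Defs.v *)
From mathcomp Require Import all_boot.

Set Implicit Arguments.
Unset Strict Implicit.
Unset Printing Implicit Defensive.

Section SignedGraph.

(* The graph with vertex type V and edge set E; it is simple when every member
   of E has exactly two elements. *)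
Variables (V : finType) (E : {set {set V}}).

Definition edge := {e : {set V} | e \in E}.

(* true stands for the sign +, false for the sign -. *)
Definition signature := {ffun edge -> bool}.

(* C is a clustering of the signed graph (V, F, s restricted to F). *)
Definition clustering (s : signature) (F : {set edge}) (C : {set {set V}}) :=
  [&& partition C [set: V],
      [forall e in F, forall B in C, (val e \subset B) ==> s e]
    & [forall e in F, forall B1 in C, forall B2 in C,
        [&& B1 != B2, val e :&: B1 != set0 & val e :&: B2 != set0]
        ==> ~~ s e]].

Definition clusterable (s : signature) (F : {set edge}) :=
  [exists C, clustering s F C].

Lemma clusterable_delete_all (s : signature) : clusterable s (~: [set: edge]).
Proof.
rewrite setCT; apply/existsP; exists (preim_partition id [set: V]).
rewrite /clustering preim_partitionP /=.
by apply/andP; split; apply/forallP => e; rewrite inE.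
Qed.

(* By clusterable_delete_all the default value of this arg min is feasible, so
   it is a genuine minimiser. *)
Definition inclusterability_index (s : signature) : nat :=
  #|[arg min_(D < [set: edge] | clusterable s (~: D)) #|D|]|.

End SignedGraph.

(* {0, ..., 4} plays the role of {1, ..., 5}. *)
Definition petersen_vertex := {A : {set 'I_5} | #|A| == 2}.

Definition petersen_edges : {set {set petersen_vertex}} :=
  [set [set uv.1; uv.2] | uv : petersen_vertex * petersen_vertex
                        & [disjoint val uv.1 & val uv.2]].

(* Main.v *)
Require Import Defs.
From mathcomp Require Import all_boot.

(** A signed graph is clusterable iff its vertices can be coloured so that an
    edge is positive exactly when it is monochromatic; hence Q is the minimum,
    over all colourings, of the number of edges violating this rule.

    Upper bound: in P the vertices 02, 03, 04 are independent, and the other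
    seven induce a tree.  Colour the tree with two colours, violating nothing,
    then give each of the three remaining vertices the colour preferred by at
    least two of its three edges: at most one violation at each.

    Lower bound: let the negative edges be 12-34, 13-24 and 14-23.  Each of the
    12 pentagons of P contains exactly one of them, hence a violated edge, and
    each edge lies in 4 pentagons, so at least 12/4 = 3 edges are violated. *)

Set Implicit Arguments.
Unset Strict Implicit.
Unset Printing Implicit Defensive.

(** * Clusterings as vertex colourings *)

Section Colourings.

Variables (V : finType) (E : {set {set V}}).
Implicit Type s : signature E.

Definition monochromatic (T : eqType) (c : V -> T) (A : {set V}) :=
  [forall u in A, forall v in A, c u == c v].

Lemma monochromaticP (T : eqType) (c : V -> T) (A : {set V}) :
  reflect {in A &, forall u v, c u = c v} (monochromatic c A).
Proof.
apply: (iffP forall_inP) => [mono u v uA vA | mono u uA].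
  by have /forall_inP/(_ v vA)/eqP := mono u uA.
by apply/forall_inP => v vA; rewrite (mono u v).
Qed.

Lemma monochromatic_set2 (T : eqType) (c : V -> T) u v :
  monochromatic c [set u; v] = (c u == c v).
Proof.
apply/monochromaticP/eqP => [mono | cuv x y].
  by apply: mono; rewrite !inE eqxx ?orbT.
by rewrite !inE => /orP[] /eqP-> /orP[] /eqP->.
Qed.

Definition violated s (T : eqType) (c : V -> T) : {set edge E} :=
  [set e | s e != monochromatic c (val e)].

(** After deletion of the violated edges, the colour classes form a clustering. *)
Lemma inclusterability_index_le_violated s (T : eqType) (c : V -> T) :
  inclusterability_index s <= #|violated s c|.
Proof.
rewrite /inclusterability_index.
case: arg_minnP => [|D _ minD]; first exact: clusterable_delete_all.
apply: minD; apply/existsP; exists (preim_partition c [set: V]).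
have sat e : e \in ~: violated s c -> s e = monochromatic c (val e).
  by rewrite !inE negbK => /eqP.
have part := preim_partitionP c [set: V].
have triv := partition_trivIset part.
have equivc : {in [set: V] & &, equivalence_rel [rel x y | c x == c y]}.
  by move=> x y z _ _ _; split=> //= /eqP->.
have same B u v : B \in preim_partition c [set: V] -> u \in B ->
    (v \in B) = (c u == c v).
  move=> BP uB; rewrite -(def_pblock triv BP uB).
  by rewrite pblock_equivalence_partition ?inE.
apply/and3P; split=> //.
  apply/forall_inP => e /sat->; apply/forall_inP => B BP.
  apply/implyP => /subsetP eB; apply/monochromaticP => u v /eB uB /eB vB.
  by apply/eqP; rewrite -(same B).
apply/forall_inP => e /sat->; apply/forall_inP => B1 B1P.
apply/forall_inP => B2 B2P; apply/implyP => /and3P[neqB].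
case/set0Pn => u /setIP[ue uB1] /set0Pn[v /setIP[ve vB2]].
apply: contra neqB => /monochromaticP/(_ u v ue ve)/eqP.
rewrite -(same B1) // => vB1.
by rewrite -(def_pblock triv B1P vB1) (def_pblock triv B2P vB2).
Qed.

(** Colour each vertex by its cluster in an optimal clustering: any violated edge must have been
    deleted. A nonempty monochromatic edge lies in the cluster of any of its vertices. *)
Lemma violated_le_inclusterability_index s :
  set0 \notin E ->
  exists c : V -> {set V}, #|violated s c| <= inclusterability_index s.
Proof.
move=> E0; rewrite /inclusterability_index.
case: arg_minnP => [|D /existsP[C]]; first exact: clusterable_delete_all.
case/and3P => part /forall_inP inside /forall_inP across _.
exists (pblock C); apply: subset_leq_card; apply/subsetP => e.
have cov x : x \in cover C by rewrite (cover_partition part) inE.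
rewrite inE; apply: contraR => eD; apply/eqP.
have eF : e \in ~: D by rewrite inE.
have [mono | /monochromaticP mono] := boolP (monochromatic _ _).
  have /set0Pn[u ue] : val e != set0 by apply: contraNneq E0 => <-; apply: valP.
  have /forall_inP/(_ _ (pblock_mem (cov u)))/implyP := inside e eF.
  apply; apply/subsetP => v ve.
  by move/monochromaticP: mono => /(_ u v ue ve)->; rewrite mem_pblock.
apply/negbTE/negP => se; case: mono => u v ue ve; apply/eqP/negPn/negP => neq.
have /forall_inP/(_ _ (pblock_mem (cov u))) := across e eF.
move/forall_inP/(_ _ (pblock_mem (cov v))); rewrite neq se /= implybF => /nandP[].
  by case/negP; apply/set0Pn; exists u; rewrite inE ue mem_pblock cov.
by case/negP; apply/set0Pn; exists v; rewrite inE ve mem_pblock cov.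
Qed.

(* Extends s by the junk value false to sets that are not edges. *)
Definition sign s (A : {set V}) : bool := oapp s false (insub A).

(** Passes from the subtype of edges to an explicit list, where counting is a computation. *)
Lemma card_violated s (T : eqType) (c : V -> T) (r : seq {set V}) :
  uniq r -> r =i E ->
  #|violated s c| = count (fun A => sign s A != monochromatic c A) r.
Proof.
move=> r_uniq rE; rewrite -(card_imset _ val_inj) -size_filter.
rewrite -(card_uniqP (filter_uniq _ r_uniq)); apply: eq_card => A.
rewrite mem_filter rE; apply/imsetP/andP => [[e] | [viol AE]].
  by rewrite inE => viol ->; rewrite /sign valK; split=> //; apply: valP.
exists (Sub A AE : edge E); rewrite ?SubK // inE SubK.
by move: viol; rewrite /sign insubT.
Qed.

End Colourings.

(** * Numerical labels for the vertices of P *)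

(* The label ij, with i < j < 5, stands for the vertex {i, j}; thus 01 = 1. *)
Definition labels : seq nat := [:: 01; 02; 03; 04; 12; 13; 14; 23; 24; 34].

Definition digits (n : nat) : seq nat := [:: n %/ 10; n %% 10].

(** Filtering [iota 0 5] unfolds to five membership tests, so that vertices can be enumerated by
    case analysis. *)
Definition elements (A : {set 'I_5}) : seq nat :=
  [seq i <- iota 0 5 | inord i \in A].

Definition label (v : petersen_vertex) : nat :=
  foldl (fun n i => n * 10 + i) 0 (elements (val v)).

Lemma elementsE A : elements A = [seq val i | i <- enum A].
Proof.
rewrite /elements -val_enum_ord filter_map; congr map.
by rewrite enumT; apply: eq_filter => i /=; rewrite inord_val.
Qed.

Lemma mem_elements A (i : 'I_5) : (val i \in elements A) = (i \in A).
Proof. by rewrite elementsE mem_map ?mem_enum //; apply: val_inj. Qed.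

Lemma elements_vertex (v : petersen_vertex) :
  elements (val v) \in map digits labels.
Proof.
have: size (elements (val v)) == 2 by rewrite elementsE size_map -cardE (valP v).
rewrite /elements /=.
by do 5![case: (inord _ \in _)].
Qed.

Lemma digits_label v : digits (label v) = elements (val v).
Proof.
rewrite /label; have /mapP[n nl ->] := elements_vertex v.
by apply/eqP; move: n nl; apply/allP.
Qed.

Lemma label_in v : label v \in labels.
Proof.
rewrite /label; have /mapP[n nl ->] := elements_vertex v.
by move: n nl; apply/allP.
Qed.

Lemma label_inj : injective label.
Proof.
move=> u v eq_uv; apply/val_inj/setP => i.
by rewrite -!mem_elements -!digits_label eq_uv.
Qed.

Lemma disjoint_label (u v : petersen_vertex) :
  [disjoint val u & val v] = ~~ has (mem (digits (label u))) (digits (label v)).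
Proof.
rewrite !digits_label; apply/idP/hasPn => [dis x | dis].
  rewrite elementsE => /mapP[i]; rewrite mem_enum => iv -> /=.
  by rewrite mem_elements (disjointFl dis).
rewrite disjoint_subset; apply/subsetP => i iu; rewrite inE.
by apply: contraL iu; rewrite -!mem_elements => /dis.
Qed.

Lemma label_onto n : n \in labels -> exists v, label v = n.
Proof.
move=> nl; pose A : {set 'I_5} := [set i | val i \in digits n].
have eA : elements A = digits n.
  transitivity [seq i <- iota 0 5 | i \in digits n].
    by apply: eq_in_filter => i; rewrite mem_iota inE /= => lti; rewrite inordK.
  by apply/eqP; move: n nl {A}; apply/allP.
have cA : #|A| == 2 by rewrite cardE -(size_map val) -elementsE eA.
exists (Sub A cA); rewrite /label SubK eA.
by apply/eqP; move: n nl {A eA cA}; apply/allP.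
Qed.

(** The implication under the quantifier lets [xchoose] give a total function. *)
Fact vertex_exists n : exists v, (n \in labels) ==> (label v == n).
Proof.
have [nl | _] := boolP (n \in labels).
  by have [v <-] := label_onto nl; exists v; rewrite eqxx.
by have [v _] := @label_onto 01 isT; exists v.
Qed.

(* An arbitrary vertex if n is not a label. *)
Definition vertex n : petersen_vertex := xchoose (vertex_exists n).

Lemma vertexK : {in labels, cancel vertex label}.
Proof. by move=> n nl; have /implyP/(_ nl)/eqP := xchooseP (vertex_exists n). Qed.

Lemma labelK : cancel label vertex.
Proof. by move=> v; apply: label_inj; rewrite vertexK ?label_in. Qed.

(** * The fifteen edges as oriented pairs of labels *)

Definition swap (t : nat * nat) := (t.2, t.1).

(* The tree on the complement of {02, 03, 04}, then the edges at these three
   vertices; each edge is listed in one of its two orientations. *)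
Definition arcs : seq (nat * nat) :=
  [:: (01, 23); (01, 24); (01, 34); (23, 14); (24, 13); (34, 12);
      (02, 13); (02, 14); (02, 34);
      (03, 12); (03, 14); (03, 24);
      (04, 12); (04, 13); (04, 23)].

Definition ends (t : nat * nat) : {set petersen_vertex} :=
  [set vertex t.1; vertex t.2].

Lemma ends_swap t : ends (swap t) = ends t.
Proof. exact: setUC. Qed.

Lemma arcs_labels t : t \in arcs -> (t.1 \in labels) && (t.2 \in labels).
Proof. by move: t; apply/allP. Qed.

(** An unordered pair fixes an arc up to reversal, and no arc has its reverse in the list. *)
Lemma ends_inj : {in arcs &, injective ends}.
Proof.
have vinj : {in labels &, injective vertex} := can_in_inj vertexK.
move=> t t' tE t'E eq_ends.
have /andP[t1 t2] := arcs_labels tE; have /andP[t1' t2'] := arcs_labels t'E.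
have swapped : t <> swap t'.
  move=> def_t; move: tE; rewrite def_t; apply/negP.
  by move: t' t'E {def_t eq_ends t1' t2'}; apply/allP.
have loopless : t.1 != t.2 by move: t tE {eq_ends t1 t2 swapped}; apply/allP.
have: vertex t.1 \in ends t' by rewrite -eq_ends !inE eqxx.
have: vertex t.2 \in ends t' by rewrite -eq_ends !inE eqxx orbT.
rewrite !inE !(inj_in_eq vinj) //.
case: t t' loopless swapped {tE t'E t1 t2 t1' t2' eq_ends} => a b [a' b'] /=.
by move=> neq swapped /orP[] /eqP eb /orP[] /eqP ea; subst;
  rewrite ?eqxx in neq swapped *.
Qed.

Lemma ends_uniq : uniq (map ends arcs).
Proof. by rewrite map_inj_in_uniq //; apply: ends_inj. Qed.

Lemma ends_edges : map ends arcs =i petersen_edges.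
Proof.
move=> A; apply/mapP/imsetP => [[t tE ->] | [[u v]]].
  have /andP[t1 t2] := arcs_labels tE.
  exists (vertex t.1, vertex t.2) => //; rewrite inE /= disjoint_label !vertexK //.
  by move: t tE {t1 t2}; apply/allP.
rewrite inE /= disjoint_label => dis ->.
have: ((label u, label v) \in arcs) || (swap (label u, label v) \in arcs).
  have /allP/(_ _ (label_in u))/allP/(_ _ (label_in v))/implyP : all (fun a =>
    all (fun b => ~~ has (mem (digits a)) (digits b) ==>
      ((a, b) \in arcs) || (swap (a, b) \in arcs)) labels) labels by [].
  exact.
by case/orP=> ?; [exists (label u, label v) | exists (swap (label u, label v))];
  rewrite ?ends_swap // /ends !labelK.
Qed.

Lemma petersen_edges_neq0 : set0 \notin petersen_edges.
Proof.
by apply/imsetP => -[[u v] _ /setP/(_ u)]; rewrite !inE eqxx.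
Qed.

Lemma card_petersen_violated (s : signature petersen_edges) (T : eqType)
    (c : petersen_vertex -> T) :
  #|violated s c| =
  count (fun t => sign s (ends t) != (c (vertex t.1) == c (vertex t.2))) arcs.
Proof.
rewrite (card_violated s c ends_uniq ends_edges) count_map.
by apply: eq_count => t /=; rewrite monochromatic_set2.
Qed.

(** * Upper bound *)

Lemma majority (g1 g2 g3 a1 a2 a3 : bool) :
  exists b, (g1 != (b == a1)) + (g2 != (b == a2)) + (g3 != (b == a3)) <= 1.
Proof.
(* Edge i is satisfied exactly by the colour [gi == ai]. If the first two edges disagree, the third
   breaks the tie. *)
exists (if (g1 == a1) == (g2 == a2) then g1 == a1 else g3 == a3).
by case: g1 g2 g3 a1 a2 a3 => [] [] [] [] [] [].
Qed.

Lemma two_colouring (g : nat * nat -> bool) :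
  exists c : nat -> bool, count (fun t => g t != (c t.1 == c t.2)) arcs <= 3.
Proof.
(* The root 01 gets colour [true]; each other tree vertex gets the one colour that satisfies the
   edge to its parent. *)
pose c23 := g (01, 23); pose c24 := g (01, 24); pose c34 := g (01, 34).
pose c14 := g (23, 14) == c23.
pose c13 := g (24, 13) == c24.
pose c12 := g (34, 12) == c34.
have [c02 le02] := majority (g (02, 13)) (g (02, 14)) (g (02, 34)) c13 c14 c34.
have [c03 le03] := majority (g (03, 12)) (g (03, 14)) (g (03, 24)) c12 c14 c24.
have [c04 le04] := majority (g (04, 12)) (g (04, 13)) (g (04, 23)) c12 c13 c23.
exists (fun n => nth false
  [:: true; c02; c03; c04; c12; c13; c14; c23; c24; c34] (index n labels)).
have root b : (b != (true == b)) = false by case: b.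
have leaf b a : (b != (a == (b == a))) = false by case: b a => [] [].
rewrite /= !root !leaf !add0n addn0.
by have := leq_add le02 (leq_add le03 le04); rewrite -!addnA.
Qed.

(** * Lower bound *)

Definition negative : seq (nat * nat) := [:: (34, 12); (24, 13); (23, 14)].

Definition orient (t : nat * nat) := if t \in arcs then t else swap t.

(** A negative edge closed up by a path of four positive edges, all oriented as in [arcs] so that
    they can be counted there. *)
Definition pentagon (t : nat * nat) (a w b : nat) : seq (nat * nat) :=
  t :: map orient [:: (t.1, a); (a, w); (w, b); (b, t.2)].

Definition pentagons : seq (seq (nat * nat)) :=
  [:: pentagon (34, 12) 01 24 03; pentagon (34, 12) 01 23 04;
      pentagon (34, 12) 02 14 03; pentagon (34, 12) 02 13 04;
      pentagon (24, 13) 01 34 02; pentagon (24, 13) 01 23 04;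
      pentagon (24, 13) 03 14 02; pentagon (24, 13) 03 12 04;
      pentagon (23, 14) 01 34 02; pentagon (23, 14) 01 24 03;
      pentagon (23, 14) 04 13 02; pentagon (23, 14) 04 12 03].

Lemma pentagons_cover : perm_eq (flatten pentagons) (flatten (nseq 4 arcs)).
Proof. by []. Qed.

(** Otherwise the four positive edges would force one colour on the whole pentagon, while its
    negative edge requires two. *)
Lemma pentagon_violated (T : eqType) (c : nat -> T) p : p \in pentagons ->
  0 < count (fun t => (t \notin negative) != (c t.1 == c t.2)) p.
Proof.
move=> pP; rewrite -has_count; move: p pP; apply/allP => /=.
by do ![apply/andP; split=> //]; do 5![case: (c _ =P c _) => //= ?]; congruence.
Qed.

Lemma three_violated (T : eqType) (c : nat -> T) :
  3 <= count (fun t => (t \notin negative) != (c t.1 == c t.2)) arcs.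
Proof.
set viol := fun t => _.
have: 12 <= count viol (flatten pentagons).
  rewrite count_flatten; have := @pentagon_violated T c.
  rewrite -/viol; have : size pentagons = 12 by [].
  (* Each pentagon contributes at least 1; [12] is generalised to the length of the list. *)
  elim: pentagons 12 => [|p r IHr] n; first by move=> <-.
  move=> <- pos /=; rewrite -add1n leq_add ?pos ?mem_head //.
  by apply: IHr => // q qr; rewrite pos // inE qr orbT.
rewrite (permP pentagons_cover) count_flatten map_nseq sumn_nseq.
by rewrite -[12]/(3 * 4) leq_pmul2r.
Qed.

Theorem theorem10p5 :
  \max_(s : signature petersen_edges) inclusterability_index s = 3.
Proof.
apply/eqP; rewrite eqn_leq; apply/andP; split.
  apply/bigmax_leqP => s _; have [c le3] := two_colouring (sign s \o ends).
  apply: leq_trans (inclusterability_index_le_violated s (c \o label)) _.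
  rewrite card_petersen_violated; apply: leq_trans le3.
  apply: eq_leq; apply: eq_in_count.
  by move=> t /arcs_labels/andP[t1 t2] /=; rewrite !vertexK.
pose s : signature petersen_edges :=
  [ffun e => val e \notin map ends negative].
apply: leq_trans (leq_bigmax s).
have [c] := violated_le_inclusterability_index s petersen_edges_neq0.
apply: leq_trans; rewrite card_petersen_violated.
apply: leq_trans (three_violated (c \o vertex)) _.
apply: eq_leq; apply: eq_in_count => t tE /=; congr (_ != _).
have tP : ends t \in petersen_edges by rewrite -ends_edges map_f.
rewrite /sign insubT /= ffunE SubK; congr (~~ _).
(* [s] tests negativity on sets, [three_violated] on pairs; the tests agree because [ends] is
   injective on [arcs], which contains [negative]. *)
apply/idP/mapP => [tN | [t' t'N /ends_inj->//]]; first by exists t.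
by move: t' t'N; apply/allP.
Qed.
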